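(* Let $(X,c)$ and $(Y,d)$ be fuzzy closure spaces. A mapping $\theta:(X,c)\to(Y,d)$ is ČF-continuous if and only if $c(\theta^{-1}(g))\le\theta^{-1}(d(g))$ for all $g\in I^Y$.
   Context: $I=[0,1]$; a fuzzy (sub)set of a non-empty set $X$ is a map $f:X\to I$, and $I^X$ is the set of all of them, ordered pointwise, with $\vee,\wedge$ pointwise supremum/infimum. $\underline 0$ is the constant $0$ fuzzy set. A fuzzy closure space is a pair $(X,c)$ with $X$ a non-empty set and $c:I^X\to I^X$ satisfying $c(\underline 0)=\underline 0$, $f\le c(f)$, and $c(f\vee g)=c(f)\vee c(g)$ for all $f,g\in I^X$ (idempotency is not required). For $\theta:X\to Y$ and $f\in I^X$, $\theta(f)\in I^Y$ is given by $\theta(f)(y)=\sup\{f(x):\theta(x)=y\}$ if $\theta^{-1}(y)\ne\emptyset$, and $0$ otherwise; for $g\in I^Y$, $\theta^{-1}(g)\in I^X$ is $\theta^{-1}(g)(x)=g(\theta(x))$. $\theta:(X,c)\to(Y,d)$ is ČF-continuous if $\theta(c(f))\le d(\theta(f))$ for all $f\in I^X$. *)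

(* Defs.v *)
From mathcomp Require Import all_boot all_order all_algebra.
From mathcomp Require Import interval_inference boolp classical_sets reals.

Set Implicit Arguments.
Unset Strict Implicit.
Unset Printing Implicit Defensive.

Import Order.TTheory GRing.Theory Num.Theory.

Local Open Scope classical_set_scope.
Local Open Scope ring_scope.

(* [{i01 R}] is the unit interval of R, a total order for the order inherited
   from R. On [fuzzySet R X], [<=%O] and [`|`%O] are the pointwise order and the
   pointwise join of boolp.v. *)
Definition fuzzySet (R : realType) (X : Type) := X -> {i01 R}.

Definition fuzzy0 (R : realType) (X : Type) : fuzzySet R X := fun=> 0%:i01.
Arguments fuzzy0 : clear implicits.

Section Image.
Variables (R : realType) (X Y : Type) (theta : X -> Y) (f : fuzzySet R X).

Definition fibre_values (y : Y) : set R :=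
  [set (f x)%:num | x in theta @^-1` [set y]].

Lemma fibre_sup_ge0 (y : Y) : 0 <= sup (fibre_values y).
Proof.
have [->|/set0P[_ [x thx _]]] := eqVneq (fibre_values y) set0.
  by rewrite sup0.
apply: (@le_trans _ _ (f x)%:num) => //; apply: ub_le_sup; last by exists x.
by exists 1 => _ [z _ <-].
Qed.

Lemma fibre_sup_le1 (y : Y) : sup (fibre_values y) <= 1.
Proof.
have [->|/set0P nz] := eqVneq (fibre_values y) set0.
  by rewrite sup0 ler01.
by apply: ge_sup => // _ [z _ <-].
Qed.

(* [sup set0 = 0] in reals.v, so this is 0 outside the range of [theta]. *)
Definition fuzzy_image : fuzzySet R Y :=
  fun y => Itv01 (fibre_sup_ge0 y) (fibre_sup_le1 y).

End Image.

Definition fuzzy_preimage (R : realType) (X Y : Type) (theta : X -> Y)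
  (g : fuzzySet R Y) : fuzzySet R X := fun x => g (theta x).

Record fuzzyClosureSpace (R : realType) := FuzzyClosureSpace {
  carrier :> Type;
  carrier_nonempty : inhabited carrier;
  fclosure_op : fuzzySet R carrier -> fuzzySet R carrier;
  fclosure_op0 : fclosure_op (fuzzy0 R carrier) = fuzzy0 R carrier;
  fclosure_op_ge : forall f : fuzzySet R carrier, (f <= fclosure_op f)%O;
  fclosure_opU : forall f g : fuzzySet R carrier,
    fclosure_op (f `|` g)%O = (fclosure_op f `|` fclosure_op g)%O
}.

Definition CF_continuous (R : realType) (X Y : fuzzyClosureSpace R)
  (theta : X -> Y) : Prop :=
  forall f : fuzzySet R X,
    (fuzzy_image theta (fclosure_op f) <= fclosure_op (fuzzy_image theta f))%O.

(* Main.v *)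
(* The image f |-> theta(f) is left adjoint to the preimage g |-> theta^-1(g),
   and closure operators are monotone since they preserve binary joins. Both
   implications follow formally, using the counit theta(theta^-1(g)) <= g in one
   direction and the unit f <= theta^-1(theta(f)) in the other. *)
Require Import Defs.
From mathcomp Require Import all_boot all_order all_algebra.
From mathcomp Require Import interval_inference boolp classical_sets reals.

Import Order.TTheory.

(** A supremum over the fibre of [y] is at most [g y] exactly when every value on that fibre is. *)
Lemma le_fuzzy_image (R : realType) (X Y : Type) (theta : X -> Y)
    (f : fuzzySet R X) (g : fuzzySet R Y) :
  (fuzzy_image theta f <= g)%O <-> (f <= fuzzy_preimage theta g)%O.
Proof.
split=> [/lefP fg|/lefP fg]; apply/lefP.
  move=> x; apply: le_trans (fg (theta x)).
  rewrite -num_le /=; apply: ub_le_sup; last by exists x.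
  by exists 1%R => _ [z _ <-].
move=> y; rewrite -num_le /=.
(* [ge_sup] needs a nonempty set; over an empty fibre the default [sup set0 = 0] lies below any
   value in the unit interval. *)
have [->|/set0P nz] := eqVneq (fibre_values theta f y) set0.
  by rewrite sup0.
by apply: ge_sup => // _ [x <- <-]; rewrite num_le; exact: fg.
Qed.

Lemma fclosure_op_le (R : realType) (X : fuzzyClosureSpace R)
    (f g : fuzzySet R X) :
  (f <= g)%O -> (fclosure_op f <= fclosure_op g)%O.
Proof. by move=> /join_r fg; rewrite -fg fclosure_opU leUl. Qed.

Theorem theorem3p3 (R : realType) (X Y : fuzzyClosureSpace R) (theta : X -> Y) :
  CF_continuous theta <->
  (forall g : fuzzySet R Y,
     (fclosure_op (fuzzy_preimage theta g)
        <= fuzzy_preimage theta (fclosure_op g))%O).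
Proof.
split=> [cont g|cpre f]; apply/le_fuzzy_image.
  apply: (le_trans (cont _)); apply: fclosure_op_le.
  (* Counit: its transpose is reflexivity at [fuzzy_preimage theta g]. *)
  exact/le_fuzzy_image.
apply: le_trans (cpre _); apply: fclosure_op_le.
(* Unit: its transpose is reflexivity at [fuzzy_image theta f]. *)
exact/le_fuzzy_image.
Qed.
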